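(* Let $q$ be an odd prime power. (1) If $q \equiv 1 \pmod 4$, then $Q_0$ and $Q_1$ are maximal cocliques of size $\frac{q+1}{2}$ in the graph $P(q^2)$. (2) If $q \equiv 3 \pmod 4$, then $Q_0 \cup \{0\}$ and $Q_1 \cup \{0\}$ are maximal cliques of size $\frac{q+3}{2}$ in the graph $P(q^2)$.
   Context: For an odd prime power $q$, the Paley graph $P(q^2)$ is the graph with vertex set the finite field $\mathbb{F}_{q^2}$ in which two distinct elements are adjacent iff their difference is a square in the multiplicative group $\mathbb{F}_{q^2}^*$. Let $\beta$ be a primitive element of $\mathbb{F}_{q^2}$ (a generator of $\mathbb{F}_{q^2}^*$), and put $\omega := \beta^{q-1}$, so that $Q := \langle \omega \rangle$ is the subgroup of order $q+1$ of $\mathbb{F}_{q^2}^*$. Put $Q_0 := \{1, \omega^2, \omega^4, \ldots, \omega^{q-1}\}$ and $Q_1 := \{\omega, \omega^3, \omega^5, \ldots, \omega^{q}\}$. A clique is a set of pairwise adjacent vertices; a coclique is a set of pairwise non-adjacent vertices. A clique (coclique) is maximal if it is not properly contained in another clique (coclique). *)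

(* Defs.v *)
From mathcomp Require Import all_boot all_order all_algebra all_fingroup all_solvable all_field.

Set Implicit Arguments.
Unset Strict Implicit.
Unset Printing Implicit Defensive.

Import GRing.Theory.
Local Open Scope ring_scope.

Definition prime_power (q : nat) : Prop :=
  exists p k : nat, [/\ prime p, (0 < k)%N & q = (p ^ k)%N].

Definition clique (T : finType) (e : rel T) (A : {set T}) : bool :=
  [forall x in A, forall y in A, (x != y) ==> e x y].

Definition coclique (T : finType) (e : rel T) (A : {set T}) : bool :=
  [forall x in A, forall y in A, (x != y) ==> ~~ e x y].

Definition maximal_clique (T : finType) (e : rel T) (A : {set T}) : bool :=
  maxset (clique e) A.

Definition maximal_coclique (T : finType) (e : rel T) (A : {set T}) : bool :=
  maxset (coclique e) A.

(* This relation is symmetric exactly when -1 is a square in F, which is the   *)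
(* case when #|F| is the square of an odd number.                              *)
Definition paley (F : finFieldType) : rel F :=
  fun x y => (x != y) && [exists u : {unit F}, x - y == val (u ^+ 2)%g].

Definition omega (F : finFieldType) (q : nat) (beta : {unit F}) : F :=
  val (beta ^+ (q - 1))%g.

(* The exponents are 0, 2, ..., q - 1.                                         *)
Definition Q0 (F : finFieldType) (q : nat) (beta : {unit F}) : {set F} :=
  [set omega q beta ^+ (2 * i) | i : 'I_((q + 1) %/ 2)].

(* The exponents are 1, 3, ..., q.                                             *)
Definition Q1 (F : finFieldType) (q : nat) (beta : {unit F}) : {set F} :=
  [set omega q beta ^+ (2 * i + 1) | i : 'I_((q + 1) %/ 2)].

(* Main.v *)
Require Import Defs.
From mathcomp Require Import all_boot all_order all_algebra all_fingroup all_solvable all_field.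
From mathcomp Require Import zify.

Set Implicit Arguments.
Unset Strict Implicit.
Unset Printing Implicit Defensive.

Import GRing.Theory.
Local Open Scope ring_scope.

(** Put m = (q + 1)/2.  As omega has order q + 1 = 2m, the sets Q0 and Q1 are
    the sets of solutions of a ^+ m = s for s = 1 and s = -1, each with exactly
    m elements (omega_progression_roots).  A nonzero z is a square iff
    z ^+ (m * (q - 1)) = 1, and this power is -1 otherwise.  Both parts of the
    theorem concern the single relation (x - y) ^+ (m * (q - 1)) = (-1) ^+ m,
    called aligned below: m is odd when q = 1 mod 4, and then aligned means
    non-adjacent; m is even when q = 3 mod 4, and then it means adjacent.

    Let a ^+ m = s.  The q-th power map is additive and a ^+ q is the inverse
    of a, so that (x - a) ^+ q * a = x ^+ q * a - 1, and raising to the power m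
    turns aligned x a into the identity
      (1 - x ^+ q * a) ^+ m = s * (x - a) ^+ m                      (alignedE).
    If also x ^+ m = s, then x ^+ q is the inverse of x and the identity holds:
    this gives the (co)clique.

    Maximality comes from counting zeros.  If x lies outside the solution set
    and is aligned with all of it, the identity holds for m values of a, and
    its two sides are polynomials in a of degree at most m.  Their difference
    has the same m zeros as 'X^m - s, so it is a scalar multiple of it, and its
    coefficient of degree 1 vanishes since m > 1.  That coefficient is
    m * (s * x ^+ (m - 1) - x ^+ q), and m is invertible in F because 2m = q + 1
    equals 1 there.  Hence x ^+ q = s * x ^+ (m - 1), so x = 0 or x ^+ m = s
    (aligned_with_roots).  Finally 0 is adjacent to every element of the
    solution sets, hence it belongs to the clique and not to the coclique. *)

(** * Maximal cliques *)

Lemma maximal_cliqueI (T : finType) (e : rel T) (A : {set T}) :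
  {in A &, forall x y, x != y -> e x y} ->
  (forall x, {in A, forall a, x != a -> e x a} -> x \in A) ->
  maximal_clique e A.
Proof.
move=> eA maxA; apply/maxsetP; split.
  apply/forall_inP=> x Ax; apply/forall_inP=> y Ay; apply/implyP.
  exact: eA.
move=> B /forall_inP eB sAB; apply/eqP; rewrite eqEsubset sAB andbT.
apply/subsetP=> x Bx; apply: maxA => a Aa x_a.
by move/forall_inP: (eB x Bx) => /(_ a (subsetP sAB a Aa))/implyP; apply.
Qed.

(** A coclique is by definition a clique of the complementary relation. *)
Lemma maximal_cocliqueI (T : finType) (e : rel T) (A : {set T}) :
  {in A &, forall x y, x != y -> ~~ e x y} ->
  (forall x, {in A, forall a, x != a -> ~~ e x a} -> x \in A) ->
  maximal_coclique e A.
Proof. exact: (@maximal_cliqueI T (fun x y => ~~ e x y)). Qed.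

(** * Polynomials vanishing on the roots of X^m - s *)

(** Subtracting the multiple of 'X^m - s with the same coefficient of degree m
    leaves degree below m, but still m zeros. *)
Lemma proportional_XnsubC (F : fieldType) (m : nat) (s : F) (rs : seq F)
    (p : {poly F}) :
  (0 < m)%N -> uniq rs -> size rs = m -> {in rs, forall a, a ^+ m = s} ->
  (size p <= m.+1)%N -> {in rs, forall a, p.[a] = 0} ->
  p = p`_m *: ('X^m - s%:P).
Proof.
move=> m_gt0 rs_uniq rs_size rs_s p_size p_rs; apply/eqP; rewrite -subr_eq0.
apply/eqP/(@roots_geq_poly_eq0 _ _ rs) => //.
  apply/allP=> a a_rs; rewrite rootE !hornerE ?hornerXn p_rs // rs_s //.
  by rewrite subrr mulr0 subr0.
rewrite rs_size; apply/leq_sizeP=> j; rewrite leq_eqVlt => /predU1P[<-|m_j].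
  by rewrite !coefE eqxx (gtn_eqF m_gt0) subr0 mulr1 subrr.
rewrite !coefE (gtn_eqF m_j) (gtn_eqF (leq_ltn_trans (leq0n m) m_j)).
by rewrite subrr mulr0 subr0 nth_default // (leq_trans p_size).
Qed.

(** The difference of the two sides, as a polynomial in a, is a multiple of
    'X^m - s; the conclusion is that its coefficient of degree 1 is zero. *)
Lemma eq_of_affine_powers_agree (F : fieldType) (m : nat) (s b x : F)
    (rs : seq F) :
  (1 < m)%N -> m%:R != 0 :> F ->
  uniq rs -> size rs = m -> {in rs, forall a, a ^+ m = s} ->
  {in rs, forall a, (1 - b * a) ^+ m = s * (x - a) ^+ m} ->
  b = s * x ^+ m.-1.
Proof.
move=> m_gt1 m_neq0 rs_uniq rs_size rs_s agree.
pose p : {poly F} := (1 - b *: 'X) ^+ m - s *: (x%:P - 'X) ^+ m.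
have size_lin (u v : F) : (size ((u%:P + v *: 'X) ^+ m)%R <= m.+1)%N.
  apply: leq_trans (size_poly_exp_leq _ _) _; rewrite ltnS -{2}[m]mul1n leq_mul2r.
  suff: (size (u%:P + v *: 'X)%R <= 2)%N by lia.
  rewrite (leq_trans (size_polyD _ _)) // geq_max size_polyC.
  rewrite (leq_trans (size_scale_leq _ _)) ?size_polyX // andbT.
  by case: (u != 0).
have /proportional_XnsubC p_eq: (size p <= m.+1)%N.
  rewrite (leq_trans (size_polyD _ _)) // geq_max size_polyN.
  rewrite (leq_trans (size_scale_leq _ _)).
    by rewrite -scaleNr -[1]/(1%:P) size_lin.
  by rewrite -[_ - 'X]/(_ + - 'X) -scaleN1r size_lin.
have {}p_eq := p_eq s rs (ltnW m_gt1) rs_uniq rs_size rs_s.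
have p_rs : {in rs, forall a, p.[a] = 0}.
  by move=> a a_rs; rewrite /p !hornerE ?horner_exp ?hornerE agree ?subrr.
(* The coefficient of degree 1 is read off as the derivative at 0. *)
have /(congr1 (fun r : {poly F} => r^`().[0])) := p_eq p_rs.
have m1 : (m.-1 == 0%N) = false by lia.
move: (p`_m) => c; rewrite /p !derivE !deriv_exp !derivE.
rewrite !(hornerE, hornerMn, horner_exp) expr0n m1.
rewrite !(mulr0n, mul0rn, subr0, expr1n, mulr1, mulr0).
rewrite mulN1r !mulNrn mulrN opprK mulrnAr addrC -mulrnBl -mulr_natr.
move/eqP; rewrite mulf_eq0 (negPf m_neq0) orbF subr_eq0.
by move/eqP.
Qed.

(** * Squares in a finite field of odd order *)

(** In the cyclic group of units, of order 2h, the power g ^+ k of a generator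
    g is killed by h iff 2h divides k * h, that is, iff k is even. *)
Lemma euler_criterion (F : finFieldType) (h : nat) (z : F) :
  #|F| = h.*2.+1 -> z != 0 ->
  [exists u : {unit F}, z == val (u ^+ 2)%g] = (z ^+ h == 1).
Proof.
move=> cardF z_neq0; have Uz : z \is a GRing.unit by rewrite unitfE.
have cardU := card_finField_unit F; rewrite cardF /= in cardU.
pose w : {unit F} := FinRing.unit F Uz; have -> : z = val w by [].
apply/existsP/eqP=> [[u /eqP/val_inj ->]|].
  rewrite -FinRing.val_unitX -expgM mul2n -cardU.
  by rewrite expg_cardG ?inE ?FinRing.val_unit1.
rewrite -FinRing.val_unitX -FinRing.val_unit1 => /val_inj w_h.
have /cyclicP[g g_gen] := field_unit_group_cyclic [set: {unit F}]%G.
have: w \in <[g]>%g by rewrite -g_gen inE.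
case/cycleP=> k w_k; exists (g ^+ k./2)%g; rewrite -expgM muln2.
suff k_even : ~~ odd k by rewrite even_halfK // w_k.
move/eqP: w_h; rewrite w_k -expgM -order_dvdn orderE -g_gen cardU.
have h_gt0 : (0 < h)%N.
  have := card_finNzRing_gt1 F; rewrite cardF; lia.
by rewrite -mul2n dvdn_pmul2r // dvdn2.
Qed.

(** * Adjacency to the solutions of a ^+ m = s *)

Section SquareOrder.

Variables (F : finFieldType) (q m : nat).
Hypotheses (q_pp : prime_power q) (cardF : #|F| = (q ^ 2)%N).
Hypotheses (q_m : q.+1 = m.*2) (m_gt1 : (1 < m)%N).

Lemma q_pchar_power : exists p k, [/\ p \in [pchar F], (0 < k)%N & q = (p ^ k)%N].
Proof.
have [p [k [p_pr k_gt0 q_pk]]] := q_pp; exists p, k; split=> //.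
by apply: (@card_finPcharP _ p (k * 2)); rewrite // cardF q_pk expnM.
Qed.

Lemma qth_powerB (x y : F) : (x - y) ^+ q = x ^+ q - y ^+ q.
Proof.
have [p [k [pF k_gt0 q_pk]]] := q_pchar_power.
have qF : [pchar F].-nat q.
  by rewrite (eq_pnat _ (pcharf_eq pF)) q_pk pnatX pnat_id ?(pcharf_prime pF).
have q_odd : odd q by lia.
by rewrite exprDn_pchar // exprNn -signr_odd q_odd expr1 mulN1r.
Qed.

(** Since 2m = q + 1 and q vanishes in F. *)
Lemma mulr_m2 : m%:R * 2%:R = 1 :> F.
Proof.
have [p [k [pF k_gt0 q_pk]]] := q_pchar_power.
rewrite -natrM muln2 -q_m -natr1 q_pk natrX (pcharf0 pF).
by rewrite expr0n (gtn_eqF k_gt0) add0r.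
Qed.

Lemma m_neq0 : m%:R != 0 :> F.
Proof.
by apply/eqP=> m0; have /eqP := mulr_m2; rewrite m0 mul0r eq_sym oner_eq0.
Qed.

Lemma N1_neq1 : (-1 : F) != 1.
Proof.
rewrite eq_sym -subr_eq0 opprK -mulr2n; apply/eqP=> two0.
by have /eqP := mulr_m2; rewrite two0 mulr0 eq_sym oner_eq0.
Qed.

(** Raising to the power m * (q - 1) is the quadratic character of F; the sign
    (-1) ^+ m makes this adjacency for even m and non-adjacency for odd m, so
    that the cliques and the cocliques are treated together. *)
Definition aligned (x y : F) := (x - y) ^+ (m * (q - 1)) == (-1) ^+ m.

Lemma paleyE (x y : F) :
  x != y -> paley x y = ((x - y) ^+ (m * (q - 1)) == 1).
Proof.
move=> xy; rewrite /paley xy (euler_criterion (h := m * (q - 1))) ?subr_eq0 //.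
rewrite cardF; nia.
Qed.

Lemma half_power_sign (z : F) :
  z != 0 -> (z ^+ (m * (q - 1)) == -1) = (z ^+ (m * (q - 1)) != 1).
Proof.
move=> z_neq0; set t := z ^+ _.
have t2 : t ^+ 2 = 1.
  rewrite -exprM; apply: (mulfI z_neq0); rewrite -exprS mulr1 -[RHS]expf_card.
  by congr (_ ^+ _); rewrite cardF; nia.
move/eqP: t2; rewrite sqrf_eq1 => /orP[]/eqP->.
  by rewrite eqxx eq_sym (negPf N1_neq1).
by rewrite eqxx N1_neq1.
Qed.

Lemma sqr1_neq0 (s : F) : s ^+ 2 = 1 -> s != 0.
Proof. by apply: contra_eqN => /eqP->; rewrite expr0n eq_sym oner_eq0. Qed.

(** The exponent m * (q - 1) is traded for q * m by multiplying by (x - a) ^+ m,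
    and the q-th power is computed from a ^+ q.+1 = s ^+ 2 = 1. *)
Lemma alignedE (s x a : F) :
  s ^+ 2 = 1 -> a ^+ m = s -> x != a ->
  aligned x a = ((1 - x ^+ q * a) ^+ m == s * (x - a) ^+ m).
Proof.
move=> s2 a_s x_a; have z_neq0 : x - a != 0 by rewrite subr_eq0.
have conj_z : 1 - x ^+ q * a = - ((x - a) ^+ q * a).
  rewrite qth_powerB mulrBl -exprSr q_m -muln2 exprM a_s s2.
  by rewrite opprB.
have s_neq0 := sqr1_neq0 s2.
have -> : aligned x a = ((x - a) ^+ (q * m) == (-1) ^+ m * (x - a) ^+ m).
  rewrite /aligned -(inj_eq (mulIf (expf_neq0 m z_neq0))) -exprD.
  congr (_ ^+ _ == _); nia.
rewrite conj_z [X in _ = (X == _)]exprNn exprMn a_s -exprM mulrA.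
rewrite [X in _ = (X == _)]mulrC (inj_eq (mulfI s_neq0)).
rewrite -[LHS](inj_eq (mulfI (negbT (signr_eq0 F m)))).
by rewrite mulrA -expr2 sqrr_sign mul1r.
Qed.

(** Here x ^+ q is the inverse of x, so that the two sides of alignedE become
    equal after multiplication by s = x ^+ m. *)
Lemma aligned_roots (s x a : F) :
  s ^+ 2 = 1 -> x ^+ m = s -> a ^+ m = s -> x != a -> aligned x a.
Proof.
move=> s2 x_s a_s x_a; rewrite (alignedE s2 a_s x_a); apply/eqP.
have x_norm : x * x ^+ q = 1 by rewrite -exprS q_m -muln2 exprM x_s s2.
have s_neq0 := sqr1_neq0 s2.
apply: (mulfI s_neq0); rewrite mulrA -expr2 s2 mul1r -x_s -exprMn.
by rewrite mulrBr mulr1 mulrA x_norm mul1r.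
Qed.

(** The maximality argument: an x outside the solution set that is aligned with
    all of it satisfies x ^+ q = s * x ^+ m.-1 by eq_of_affine_powers_agree, and
    x ^+ m.-1 can be cancelled because q = m + m.-1. *)
Lemma aligned_with_roots (s x : F) :
  s ^+ 2 = 1 -> #|[set a : F | a ^+ m == s]| = m ->
  (forall a, a ^+ m = s -> x != a -> aligned x a) -> x = 0 \/ x ^+ m = s.
Proof.
move=> s2 card_s x_al; have [->|x_neq0] := eqVneq x 0; first by left.
right; apply/eqP; case: (boolP (x ^+ m == s)) => // x_s.
have: x ^+ q = s * x ^+ m.-1.
  apply: (eq_of_affine_powers_agree (rs := enum [set a : F | a ^+ m == s])) => //.
  - exact: m_neq0.
  - exact: enum_uniq.
  - by rewrite -cardE.
  - by move=> a; rewrite mem_enum inE => /eqP.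
  move=> a; rewrite mem_enum inE => /eqP a_s.
  have x_a : x != a by apply: contraNneq x_s => ->; rewrite a_s.
  by apply/eqP; rewrite -(alignedE s2 a_s x_a) x_al.
have -> : q = (m + m.-1)%N by lia.
rewrite exprD => /(mulIf (expf_neq0 _ x_neq0)) x_s'.
by rewrite x_s' eqxx in x_s.
Qed.

(** The solutions of a ^+ m = s are squares, being killed by m * (q - 1), which
    is a multiple of 2m; hence all of them are adjacent to 0. *)
Lemma aligned_zero (s a : F) :
  s ^+ 2 = 1 -> a ^+ m = s -> aligned 0 a = ~~ odd m.
Proof.
move=> s2 a_s; rewrite /aligned sub0r.
have -> : (m * (q - 1) = 2 * (m * m.-1))%N by nia.
rewrite exprM sqrrN -exprM mulnCA exprM a_s exprM s2.
rewrite expr1n -signr_odd; case: (odd m); last by rewrite eqxx.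
by rewrite expr1 eq_sym (negPf N1_neq1).
Qed.

(** * The two families of maximal sets *)

Lemma maximal_coclique_roots (s : F) (A := [set a : F | a ^+ m == s]) :
  odd m -> s ^+ 2 = 1 -> #|A| = m -> maximal_coclique (@paley F) A.
Proof.
move=> m_odd s2 cardA.
have nonadj (x y : F) : x != y -> ~~ paley x y = aligned x y.
  move=> x_y; rewrite (paleyE x_y) /aligned.
  by rewrite -half_power_sign ?subr_eq0 // -signr_odd m_odd.
have A_al (x a : F) : x \in A -> a \in A -> x != a -> aligned x a.
  by rewrite !inE => /eqP x_s /eqP; apply: aligned_roots s2 x_s.
apply: maximal_cocliqueI => [x y xA yA x_y|x x_al].
  by rewrite nonadj ?A_al.
have [|x0|/eqP] := @aligned_with_roots s x s2 cardA; last by rewrite inE.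
  by move=> a a_s x_a; rewrite -nonadj // x_al // inE a_s.
(* The remaining candidate x = 0 is adjacent to any solution a. *)
have /card_gt0P[a aA] : (0 < #|A|)%N by rewrite cardA ltnW.
have [<- //|x_a] := eqVneq a x.
have /eqP a_s : a ^+ m == s by move: aA; rewrite inE.
have: aligned x a by rewrite -nonadj 1?eq_sym // x_al // eq_sym.
by rewrite x0 (aligned_zero s2 a_s) m_odd.
Qed.

Lemma maximal_clique_roots (s : F) (A := [set a : F | a ^+ m == s]) :
  ~~ odd m -> s ^+ 2 = 1 -> #|A| = m ->
  maximal_clique (@paley F) (A :|: [set 0]).
Proof.
move=> m_even s2 cardA.
have adj (x y : F) : x != y -> paley x y = aligned x y.
  by move=> x_y; rewrite (paleyE x_y) /aligned -signr_odd (negPf m_even).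
have aligned_sym (x y : F) : aligned x y = aligned y x.
  rewrite /aligned -opprB; have -> : (m * (q - 1) = 2 * (m * m.-1))%N by nia.
  by rewrite !(exprM _ 2) sqrrN.
apply: maximal_cliqueI => [x y|x x_al].
  rewrite !inE => /orP[/eqP x_s|/eqP->] /orP[/eqP y_s|/eqP->] x_y; rewrite adj //.
  - exact: aligned_roots s2 x_s y_s x_y.
  - by rewrite aligned_sym (aligned_zero s2 x_s).
  - by rewrite (aligned_zero s2 y_s).
  by rewrite eqxx in x_y.
have [|->|/eqP] := @aligned_with_roots s x s2 cardA.
- by move=> a a_s x_a; rewrite -adj // x_al // !inE a_s eqxx.
- by rewrite !inE eqxx orbT.
by rewrite !inE => ->.
Qed.

(** * Progressions of powers of omega *)

Variable beta : {unit F}.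
Hypothesis beta_gen : generator [set: {unit F}] beta.

Lemma omega_prim : q.+1.-primitive_root (omega q beta).
Proof.
have -> : omega q beta = val beta ^+ ((q ^ 2).-1 %/ q.+1).
  rewrite /omega FinRing.val_unitX; congr (_ ^+ _).
  have -> : (q ^ 2).-1 = ((q - 1) * q.+1)%N by nia.
  by rewrite mulnK.
have beta_order : #[beta]%g = (q ^ 2).-1.
  by rewrite orderE -(eqP beta_gen) card_finField_unit cardF.
apply: (@dvdn_prim_root _ (q ^ 2).-1); last first.
  by apply/dvdnP; exists (q - 1)%N; nia.
apply/andP; split; first nia.
apply/forallP=> i; rewrite unity_rootE -FinRing.val_unitX -FinRing.val_unit1.
rewrite val_eqE -order_dvdn beta_order; apply/eqP.
apply/idP/eqP=> [/dvdn_leq le_i|-> //]; apply/eqP.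
by rewrite eqn_leq ltn_ord le_i.
Qed.

Lemma omega_half : omega q beta ^+ m = -1.
Proof.
have: (omega q beta ^+ m) ^+ 2 == 1.
  by rewrite -exprM muln2 -q_m (prim_expr_order omega_prim).
rewrite sqrf_eq1 -(prim_order_dvd omega_prim) => /orP[/dvdn_leq|/eqP//]; lia.
Qed.

(** The powers listed are m distinct solutions, since omega ^+ m = -1, and a
    polynomial of degree m has no more zeros. *)
Lemma omega_progression_roots (d : nat) :
  let A := [set omega q beta ^+ (2 * i + d) | i : 'I_((q + 1) %/ 2)] in
  A = [set a | a ^+ m == (-1) ^+ d] /\ #|A| = m.
Proof.
have half : ((q + 1) %/ 2)%N = m by lia.
move=> A; have cardA : #|A| = m.
  rewrite card_imset ?card_ord // => i j /eqP.
  rewrite (eq_prim_root_expr omega_prim) eqn_modDr.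
  have := ltn_ord i; have := ltn_ord j => j_lt i_lt.
  (* The exponents 2i, without the common shift d, are below q + 1. *)
  rewrite !modn_small; [|lia|lia].
  by move=> /eqP ij; apply: val_inj => /=; lia.
split=> //; apply/eqP; rewrite eqEcard cardA; apply/andP; split.
  apply/subsetP=> _ /imsetP[i _ ->]; rewrite inE.
  by rewrite exprAC omega_half exprD exprM sqrrN !expr1n mul1r.
have size_p := size_XnsubC ((-1) ^+ d : F) (ltnW m_gt1).
have p_neq0 : 'X^m - ((-1) ^+ d)%:P != 0 :> {poly F} by rewrite -size_poly_gt0 size_p.
rewrite -ltnS -size_p cardE; apply: max_poly_roots (enum_uniq _) => //.
apply/allP=> a; rewrite mem_enum inE => /eqP a_d.
by rewrite rootE !hornerE ?hornerXn a_d subrr.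
Qed.

End SquareOrder.

Theorem theorem1 (q : nat) (F : finFieldType) (beta : {unit F})
    (q_odd : odd q) (q_pp : prime_power q)
    (cardF : #|F| = (q ^ 2)%N)
    (beta_gen : generator [set: {unit F}] beta) :
  (q = 1 %[mod 4] ->
     [/\ maximal_coclique (@paley F) (Q0 q beta),
         #|Q0 q beta| = ((q + 1) %/ 2)%N,
         maximal_coclique (@paley F) (Q1 q beta)
       & #|Q1 q beta| = ((q + 1) %/ 2)%N]) /\
  (q = 3 %[mod 4] ->
     [/\ maximal_clique (@paley F) (Q0 q beta :|: [set 0]),
         #|Q0 q beta :|: [set 0]| = ((q + 3) %/ 2)%N,
         maximal_clique (@paley F) (Q1 q beta :|: [set 0])
       & #|Q1 q beta :|: [set 0]| = ((q + 3) %/ 2)%N]).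
Proof.
pose m := ((q + 1) %/ 2)%N.
have q_m : q.+1 = m.*2 by rewrite /m; lia.
have m_gt1 : (1 < m)%N.
  have [p [k [p_pr k_gt0 q_pk]]] := q_pp.
  have q_gt1 : (1 < q)%N by rewrite q_pk -(exp1n k) ltn_exp2r ?prime_gt1.
  by rewrite /m; lia.
have [Q0_roots cardQ0] : Q0 q beta = [set a | a ^+ m == 1] /\ #|Q0 q beta| = m.
  have := omega_progression_roots cardF q_m m_gt1 beta_gen 0.
  rewrite (_ : [set _ | _ : 'I__] = Q0 q beta) //.
  by apply: eq_imset => i /=; rewrite addn0.
have [Q1_roots cardQ1] : Q1 q beta = [set a | a ^+ m == -1] /\ #|Q1 q beta| = m.
  by have := omega_progression_roots cardF q_m m_gt1 beta_gen 1; rewrite expr1.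
have N1_sqr : (-1) ^+ 2 = 1 :> F by rewrite sqrrN expr1n.
have card_with0 (s : F) : s ^+ 2 = 1 -> #|[set a : F | a ^+ m == s]| = m ->
    #|[set a : F | a ^+ m == s] :|: [set 0]| = ((q + 3) %/ 2)%N.
  move=> s2 cards; rewrite setUC cardsU1 cards inE expr0n gtn_eqF ?(ltnW m_gt1) //.
  by rewrite eq_sym -sqrf_eq0 s2 oner_eq0 /m; lia.
rewrite Q0_roots Q1_roots in cardQ0 cardQ1 *.
split=> q_mod.
  have m_odd : odd m by rewrite /m; lia.
  by split=> //; apply: (maximal_coclique_roots q_pp cardF q_m m_gt1);
    rewrite ?expr1n.
have m_even : ~~ odd m by rewrite /m; lia.
split; try by apply: card_with0; rewrite ?expr1n.
  by apply: (maximal_clique_roots q_pp cardF q_m m_gt1); rewrite ?expr1n.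
by apply: (maximal_clique_roots q_pp cardF q_m m_gt1).
Qed.
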